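(* Suppose that $a_n\to\infty$, $\beta_n\to\beta_\infty$ as $n\to\infty$ with $|\beta_\infty|>1$, and that $(\alpha_n')\in\ell^1(\mathbb Z_+)$, $(\beta_n')\in\ell^1(\mathbb Z_+)$, $(k_n-1)\in\ell^1$. Then the relation $$\lim_{n\to\infty}\sqrt{a_n}\,q_n(z)P_n(z)=-\frac{\varkappa_\infty\,\Omega(z)}{2\sqrt{\beta_\infty^2-1}}$$ is true for all $z\in\mathbb C$, with convergence uniform on compact subsets of $\mathbb C\setminus\mathbb R$. Moreover, if $\Omega(z)=0$, then $$\lim_{n\to\infty}\sqrt{a_n}\,q_n(z)^{-1}P_n(z)=\{P(z),g(z)\}$$ (and $\{P(z),g(z)\}\ne0$ if $\Omega(z)=0$).
   Context: $\mathbb Z_+=\{0,1,2,\dots\}$; $a_n>0$ and $b_n\in\mathbb R$ for $n\in\mathbb Z_+$, and $a_{-1}>0$ is an arbitrary fixed number. For a sequence $x_n$ put $x_n'=x_{n+1}-x_n$. Notation: $$\alpha_n=\frac1{2\sqrt{a_{n-1}a_n}},\quad \beta_n=-\frac{b_n}{2\sqrt{a_{n-1}a_n}},\quad \varkappa_n=\sqrt{\frac{a_{n+1}}{a_n}},\quad k_n=\frac{\varkappa_{n-1}}{\varkappa_n}.$$ The limit $\varkappa_\infty=\lim_{n\to\infty}\varkappa_n$ exists and is finite because $(k_n-1)\in\ell^1$. The Jacobi equation is $a_{n-1}u_{n-1}+b_nu_n+a_nu_{n+1}=zu_n$, $n\in\mathbb Z_+$, for sequences $(u_n)_{n\ge-1}$.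 The polynomials $P_n(z)$ are its solution with $P_{-1}(z)=0$, $P_0(z)=1$. The Wronskian is $\{u,v\}=a_n(u_nv_{n+1}-u_{n+1}v_n)$, independent of $n\ge-1$ for solutions. The branch of $\sqrt{z^2-1}$ on $\mathbb C\setminus[-1,1]$ is analytic and positive for $z>1$, hence negative for $z<-1$; in particular $\sqrt{\beta_\infty^2-1}$ is understood in this sense and is negative if $\beta_\infty<-1$. Put $\zeta(z)=z-\sqrt{z^2-1}$. Given $\rho_0>0$, fix $0<\varepsilon_0<|\beta_\infty|-1$ and choose $N_0=N_0(\rho_0)\ge1$ such that $|\alpha_nz+\beta_n-\beta_\infty|<\varepsilon_0$ for all $n\ge N_0$, $|z|<\rho_0$. Put $q_n(z)=\prod_{m=N_0}^{n-1}\zeta(\alpha_mz+\beta_m)$. For $|z|<\rho_0$, the Jost solution $f_n(z)$, $n\ge-1$, is the unique solution of the Jacobi equation with $f_n(z)=a_n^{-1/2}q_n(z)(1+o(1))$ as $n\to\infty$; $\Omega(z)=\{P(z),f(z)\}=-a_{-1}f_{-1}(z)$. $N_0$ is also taken so large that $f_n(z)\ne0$ for $n\ge N_0$, $|z|<\rho_0$. The second solution is $g_n(z)=f_n(z)\sum_{m=N_0+1}^n\big(a_{m-1}f_{m-1}(z)f_m(z)\big)^{-1}$ for $n\ge N_0+1$, extended to all $n\ge-1$ as a solution of the Jacobi equation. Here $\rho_0$ is arbitrary with $|z|<\rho_0$ (respectively, with the compact set contained in $\{|z|<\rho_0\}$). *)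

(* Defs.v *)
From Stdlib Require Import Reals ZArith List Lra Lia.
From Coquelicot Require Import Coquelicot.

Open Scope R_scope.

(* Sequences with indices n >= -1 are functions on Z of which only the values at
   n >= -1 are used. *)
Coercion Z.of_nat : nat >-> Z.

Definition alpha (a : Z -> R) (n : Z) : R := 1 / (2 * sqrt (a (n - 1)%Z * a n)).

Definition beta (a b : Z -> R) (n : Z) : R :=
  - (b n / (2 * sqrt (a (n - 1)%Z * a n))).

Definition varkappa (a : Z -> R) (n : Z) : R := sqrt (a (n + 1)%Z / a n).

Definition kratio (a : Z -> R) (n : Z) : R := varkappa a (n - 1) / varkappa a n.

Definition varkappa_inf (a : Z -> R) : R :=
  real (Lim_seq (fun n : nat => varkappa a n)).

Definition diff (x : Z -> R) (n : Z) : R := x (n + 1)%Z - x n.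

Definition ell1 (x : Z -> R) : Prop := ex_series (fun n : nat => Rabs (x n)).

Definition Jacobi_solution (a b : Z -> R) (z : C) (u : Z -> C) : Prop :=
  forall n : Z, (0 <= n)%Z ->
    (a (n - 1)%Z * u (n - 1)%Z + b n * u n + a n * u (n + 1)%Z = z * u n)%C.

Definition Wronskian_at (a : Z -> R) (u v : Z -> C) (n : Z) : C :=
  (a n * (u n * v (n + 1)%Z - u (n + 1)%Z * v n))%C.

(* The common value, for solutions u and v, of all Wronskian_at a u v n, n >= -1:
   see Wronskian_indep. *)
Definition Wronskian (a : Z -> R) (u v : Z -> C) : C := Wronskian_at a u v (-1).

Lemma Wronskian_indep (a b : Z -> R) (z : C) (u v : Z -> C) :
  Jacobi_solution a b z u -> Jacobi_solution a b z v ->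
  forall n : Z, (-1 <= n)%Z -> Wronskian_at a u v n = Wronskian a u v.
Proof.
intros Hu Hv n Hn.
pattern n; apply (Zlt_lower_bound_ind _ (-1)); [clear n Hn | exact Hn].
intros n IH Hn.
destruct (Z.eq_dec n (-1)) as [-> | Hn1]; [reflexivity |].
rewrite <- (IH (n - 1)%Z) by lia.
unfold Wronskian_at.
replace (n - 1 + 1)%Z with n by lia.
assert (Eu := Hu n ltac:(lia)). assert (Ev := Hv n ltac:(lia)).
assert (Fu : (a n * u (n + 1)%Z = z * u n - b n * u n - a (n - 1)%Z * u (n - 1)%Z)%C)
  by (rewrite <- Eu; ring).
assert (Fv : (a n * v (n + 1)%Z = z * v n - b n * v n - a (n - 1)%Z * v (n - 1)%Z)%C)
  by (rewrite <- Ev; ring).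
transitivity (u n * (a n * v (n + 1)%Z) - (a n * u (n + 1)%Z) * v n)%C; [ring |].
rewrite Fu, Fv; ring.
Qed.

(* Principal square root, analytic off the half-line of nonpositive reals. *)
Definition Csqrt (w : C) : C :=
  (RtoC (/ sqrt (2 * (Re w + Cmod w))) * (w + RtoC (Cmod w)))%C.

(* For z outside [-1,1], 1 - 1/z^2 avoids the cut of Csqrt, so this function is
   analytic there.  Csqrt_sq1_sqr, _pos, _neg and _analytic below check that it is
   the branch which is positive for z > 1 and negative for z < -1. *)
Definition Csqrt_sq1 (z : C) : C := (z * Csqrt (1 - / (z * z)))%C.

Definition zeta (z : C) : C := (z - Csqrt_sq1 z)%C.

Definition in_cut (z : C) : Prop := Im z = 0 /\ -1 <= Re z <= 1.

Definition slit (w : C) : Prop := 0 < Re w + Cmod w.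

Lemma Re_plus_Cmod_ge0 (w : C) : 0 <= Re w + Cmod w.
Proof.
assert (H := proj1 (Rabs_le_between _ _) (re_le_Cmod w)). lra.
Qed.

Lemma Cmod_sqr (w : C) : Cmod w * Cmod w = Re w * Re w + Im w * Im w.
Proof.
unfold Cmod, Re, Im. rewrite sqrt_sqrt by nra. simpl; ring.
Qed.

Lemma Csqrt_sqr (w : C) : slit w -> (Csqrt w * Csqrt w = w)%C.
Proof.
unfold slit, Csqrt; intros Hw.
set (s := sqrt (2 * (Re w + Cmod w))).
assert (Hs : s * s = 2 * (Re w + Cmod w)) by (apply sqrt_sqrt; lra).
assert (Hs0 : 0 < s) by (apply sqrt_lt_R0; lra).
assert (Hm := Cmod_sqr w).
assert (Hi : / s * / s = / (2 * (Re w + Cmod w)))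
  by (rewrite <- Hs; field; lra).
transitivity (RtoC (/ s * / s) * ((w + Cmod w) * (w + Cmod w)))%C.
  rewrite RtoC_mult; ring.
rewrite Hi. generalize dependent (Cmod w). destruct w as [x y]. unfold Re, Im; simpl.
intros m Hw _ _ Hm _.
apply injective_projections; simpl; field_simplify_eq; nra.
Qed.

Lemma Csqrt_Re_ge0 (w : C) : 0 <= Re (Csqrt w).
Proof.
assert (H := Re_plus_Cmod_ge0 w).
replace (Re (Csqrt w)) with (/ sqrt (2 * (Re w + Cmod w)) * (Re w + Cmod w)).
2:{ unfold Csqrt, Re, Im; simpl; ring. }
apply Rmult_le_pos; [| lra].
destruct (Rle_lt_or_eq_dec _ _ H) as [H1 | H1].
- left; apply Rinv_0_lt_compat, sqrt_lt_R0; lra.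
- rewrite <- H1, Rmult_0_r, sqrt_0, Rinv_0; lra.
Qed.

Lemma Csqrt_Re_gt0 (w : C) : slit w -> 0 < Re (Csqrt w).
Proof.
unfold slit; intros H.
replace (Re (Csqrt w)) with (/ sqrt (2 * (Re w + Cmod w)) * (Re w + Cmod w)).
2:{ unfold Csqrt, Re, Im; simpl; ring. }
apply Rmult_lt_0_compat; [| lra].
apply Rinv_0_lt_compat, sqrt_lt_R0; lra.
Qed.

Lemma Csqrt_pos (x : R) : 0 < x -> Csqrt x = RtoC (sqrt x).
Proof.
intros Hx. unfold Csqrt. rewrite Cmod_R, Rabs_pos_eq by lra.
unfold Re; simpl.
replace (2 * (x + x)) with ((2 * sqrt x) * (2 * sqrt x)).
2:{ transitivity (4 * (sqrt x * sqrt x)); [ring | rewrite sqrt_sqrt by lra; ring]. }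
assert (H := sqrt_lt_R0 x Hx).
rewrite sqrt_square by lra.
rewrite <- RtoC_plus, <- RtoC_mult. f_equal.
assert (H2 : sqrt x * sqrt x = x) by (apply sqrt_sqrt; lra).
rewrite <- H2 at 2 3. field; lra.
Qed.

Lemma not_cut_neq0 (z : C) : ~ in_cut z -> z <> 0%C.
Proof. intros H ->; apply H; unfold in_cut, Re, Im; simpl; lra. Qed.

Lemma not_slit (w : C) : ~ slit w -> Im w = 0 /\ Re w <= 0.
Proof.
unfold slit; intros H. assert (H0 := Re_plus_Cmod_ge0 w).
assert (H1 := Cmod_sqr w). assert (H2 := Cmod_ge_0 w).
assert (H3 : Cmod w = - Re w) by lra. rewrite H3 in H1, H2.
split; nra.
Qed.

Lemma not_cut_slit (z : C) : ~ in_cut z -> slit (1 - / (z * z))%C.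
Proof.
intros Hz. assert (Hz0 := not_cut_neq0 z Hz).
destruct (Rlt_dec 0 (Re (1 - / (z * z))%C + Cmod (1 - / (z * z))%C)) as [H | H];
  [exact H | exfalso].
apply not_slit in H. destruct H as [Hi Hr].
set (t := Re (/ (z * z))%C).
assert (Ht : (/ (z * z))%C = RtoC t).
{ unfold t. apply injective_projections; [reflexivity |].
  unfold Im, Re in *; simpl in *. lra. }
rewrite Ht in Hr. unfold Re in Hr; simpl in Hr.
assert (E : (RtoC t * (z * z) = 1)%C) by (rewrite <- Ht; field; exact Hz0).
apply Hz. destruct z as [x y]. unfold in_cut, Re, Im; simpl.
injection E; intros E2 E1.
assert (E3 : x * y = 0) by nra.
assert (E4 : t * (x * x - y * y) = 1) by nra.
destruct (Rmult_integral _ _ E3) as [-> | ->]; [exfalso | ]; nra.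
Qed.

Lemma Csqrt_sq1_sqr (z : C) :
  ~ in_cut z -> (Csqrt_sq1 z * Csqrt_sq1 z = z * z - 1)%C.
Proof.
intros Hz. unfold Csqrt_sq1.
transitivity (z * z * (Csqrt (1 - / (z * z)) * Csqrt (1 - / (z * z))))%C; [ring |].
rewrite Csqrt_sqr by (apply not_cut_slit; exact Hz).
field; apply not_cut_neq0; exact Hz.
Qed.

Lemma Csqrt_sq1_R (x : R) :
  1 < Rabs x -> Csqrt_sq1 x = RtoC (x * sqrt (1 - / (x * x))).
Proof.
intros Hx. unfold Csqrt_sq1.
assert (Hxx : 1 < x * x) by (revert Hx; unfold Rabs; case Rcase_abs; nra).
rewrite <- RtoC_mult, <- RtoC_inv by lra.
rewrite <- RtoC_minus, Csqrt_pos, <- RtoC_mult; [reflexivity |].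
assert (/ (x * x) < / 1) by (apply Rinv_lt_contravar; lra). lra.
Qed.

Lemma Csqrt_sq1_pos (x : R) : 1 < x -> Csqrt_sq1 x = RtoC (sqrt (x * x - 1)).
Proof.
intros Hx. rewrite Csqrt_sq1_R by (rewrite Rabs_pos_eq; lra). f_equal.
rewrite <- (sqrt_square x) at 1 by lra.
rewrite <- sqrt_mult_alt by nra. f_equal. field; lra.
Qed.

Lemma Csqrt_sq1_neg (x : R) : x < -1 -> Csqrt_sq1 x = RtoC (- sqrt (x * x - 1)).
Proof.
intros Hx. rewrite Csqrt_sq1_R by (rewrite Rabs_left; lra). f_equal.
replace (x * x) with ((- x) * (- x)) by ring.
replace x with (- - x) at 1 by ring. rewrite Ropp_mult_distr_l_reverse. f_equal.
rewrite <- (sqrt_square (- x)) at 1 by lra.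
rewrite <- sqrt_mult_alt by nra. f_equal. field; lra.
Qed.

Lemma is_C_derive_quadratic (f : C -> C) (z l : C) (M d : R) : 0 < d ->
  (forall y, Cmod (y - z) < d ->
     Cmod (f y - f z - (y - z) * l) <= M * (Cmod (y - z) * Cmod (y - z))) ->
  is_derive (K := C_AbsRing) (V := AbsRing_NormedModule C_AbsRing) f z l.
Proof.
intros Hd H. split.
  apply is_linear_scal_l.
intros x Hx.
assert (Ex : z = x)
  by exact (is_filter_lim_locally_unique (K := C_AbsRing) (V := AbsRing_NormedModule C_AbsRing) z x Hx).
subst x. intros eps.
set (A := Rabs M + 1). assert (HA : 0 < A) by (unfold A; assert (T := Rabs_pos M); lra).
assert (Hd' : 0 < Rmin d (eps / A)).
{ apply Rmin_pos; [exact Hd | apply Rdiv_lt_0_compat; [apply cond_pos | exact HA]]. }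
exists (mkposreal _ Hd'). intros y Hy.
change (Cmod (y - z) < Rmin d (eps / A)) in Hy.
assert (H1 : Cmod (y - z) < d) by (eapply Rlt_le_trans; [exact Hy | apply Rmin_l]).
assert (H2 : Cmod (y - z) < eps / A) by (eapply Rlt_le_trans; [exact Hy | apply Rmin_r]).
change (Cmod (f y - f z - (y - z) * l) <= eps * Cmod (y - z)).
eapply Rle_trans; [apply (H y H1) |].
assert (Hc := Cmod_ge_0 (y - z)).
assert (HMA : M <= A) by (unfold A; assert (T := Rle_abs M); lra).
assert (H3 : A * Cmod (y - z) <= eps).
{ apply Rmult_lt_compat_l with (r := A) in H2; [| exact HA].
  replace (A * (eps / A)) with (pos eps) in H2 by (field; lra). lra. }
nra.
Qed.

Lemma Csqrt_derivable (w : C) : slit w ->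
  ex_derive (K := C_AbsRing) (V := AbsRing_NormedModule C_AbsRing) Csqrt w.
Proof.
intros Hw.
set (c := Csqrt w). set (r := Re c).
assert (Hr : 0 < r) by (apply Csqrt_Re_gt0; exact Hw).
assert (Hc0 : c <> 0%C).
{ intros E. unfold r in Hr. rewrite E in Hr. simpl in Hr. lra. }
assert (Hcp : 0 < Cmod c) by (apply Cmod_gt_0; exact Hc0).
assert (Hd : 0 < Re w + Cmod w) by exact Hw.
set (d := (Re w + Cmod w) / 2).
exists (/ (2 * c))%C.
apply (is_C_derive_quadratic _ _ _ (/ (2 * Cmod c * (r * r))) d);
  [unfold d; lra |].
intros y Hy.
assert (Hys : slit y).
{ unfold slit.
  assert (H1 := proj1 (Rabs_le_between _ _) (re_le_Cmod (y - w))).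
  assert (H2 := Cmod_triangle (w - y)%C y).
  replace (w - y + y)%C with w in H2 by ring.
  replace (w - y)%C with (- (y - w))%C in H2 by ring. rewrite Cmod_opp in H2.
  replace (Re (y - w)%C) with (Re y - Re w) in H1 by (unfold Re; simpl; ring).
  unfold d in Hy. lra. }
set (e := Csqrt y).
assert (He : 0 <= Re e) by apply Csqrt_Re_ge0.
assert (Hw2 : w = (c * c)%C) by (symmetry; apply Csqrt_sqr; exact Hw).
assert (Hy2 : y = (e * e)%C) by (symmetry; apply Csqrt_sqr; exact Hys).
assert (Hs : r <= Cmod (e + c)).
{ assert (H1 := proj1 (Rabs_le_between _ _) (re_le_Cmod (e + c))).
  replace (Re (e + c)%C) with (Re e + Re c) in H1 by (unfold Re; simpl; ring).
  fold r in H1. lra. }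
assert (Hs0 : (e + c)%C <> 0%C).
{ intros E. rewrite E, Cmod_0 in Hs. lra. }
assert (Eq : (e - c - (y - w) * / (2 * c)
  = - ((y - w) * (y - w) * / (2 * c * ((e + c) * (e + c)))))%C).
{ rewrite Hw2, Hy2. field. split; assumption. }
fold c e. rewrite Eq, Cmod_opp, !Cmod_mult, Cmod_inv, !Cmod_mult.
2:{ apply Cmult_neq_0; apply Cmult_neq_0; try assumption.
    intros E; injection E; lra. }
rewrite Cmod_R, (Rabs_pos_eq 2) by lra.
rewrite Rmult_comm. apply Rmult_le_compat_r.
  apply Rmult_le_pos; apply Cmod_ge_0.
apply Rinv_le_contravar; [repeat apply Rmult_lt_0_compat; lra |].
apply Rmult_le_compat_l; nra.
Qed.

Lemma inv_sqr_derivable (z : C) : z <> 0%C ->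
  ex_derive (K := C_AbsRing) (V := AbsRing_NormedModule C_AbsRing)
    (fun z => 1 - / (z * z))%C z.
Proof.
intros Hz.
assert (Hm : 0 < Cmod z) by (apply Cmod_gt_0; exact Hz).
set (m := Cmod z) in *.
exists (2 * / (z * z * z))%C.
apply (is_C_derive_quadratic _ _ _ (8 * / (m * m * (m * m))) (/ 2 * m)); [lra |].
intros y Hy.
set (h := (y - z)%C) in *.
assert (Hy1 : / 2 * m <= Cmod y).
{ assert (H := Cmod_triangle (z - y)%C y).
  replace (z - y + y)%C with z in H by ring.
  replace (z - y)%C with (- h)%C in H by (unfold h; ring).
  rewrite Cmod_opp in H. fold m in H. lra. }
assert (Hy0 : y <> 0%C).
{ intros E. rewrite E, Cmod_0 in Hy1. lra. }
assert (Eq : (1 - / (y * y) - (1 - / (z * z)) - h * (2 * / (z * z * z))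
   = - (h * h * ((2 * y + z) * / (y * y * (z * z * z)))))%C).
{ unfold h. field. split; assumption. }
rewrite Eq, Cmod_opp, !Cmod_mult, Cmod_inv, !Cmod_mult
  by (repeat apply Cmult_neq_0; assumption).
fold m.
rewrite Rmult_comm. apply Rmult_le_compat_r.
  apply Rmult_le_pos; apply Cmod_ge_0.
set (k := Cmod y) in *.
assert (Hn : Cmod (2 * y + z) <= 2 * k + m).
{ eapply Rle_trans; [apply Cmod_triangle |].
  rewrite Cmod_mult, Cmod_R, (Rabs_pos_eq 2) by lra. fold k m. lra. }
apply Rle_trans with ((2 * k + m) * / (k * k * (m * m * m))).
- apply Rmult_le_compat_r; [| exact Hn].
  left. apply Rinv_0_lt_compat.
  repeat apply Rmult_lt_0_compat; lra.
- replace ((2 * k + m) * / (k * k * (m * m * m)))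
    with ((2 * m * / k + m * / k * (m * / k)) * / (m * m * (m * m)))
    by (field; lra).
  apply Rmult_le_compat_r.
  + left. apply Rinv_0_lt_compat. repeat apply Rmult_lt_0_compat; lra.
  + assert (H : m * / k <= 2).
    { replace 2 with (2 * k * / k) by (field; lra).
      apply Rmult_le_compat_r; [left; apply Rinv_0_lt_compat |]; lra. }
    assert (0 < m * / k) by (apply Rmult_lt_0_compat; [| apply Rinv_0_lt_compat]; lra).
    nra.
Qed.

Lemma Csqrt_sq1_analytic (z : C) : ~ in_cut z -> ex_derive Csqrt_sq1 z.
Proof.
intros Hz.
destruct (Csqrt_derivable _ (not_cut_slit z Hz)) as [l1 H1].
destruct (inv_sqr_derivable z (not_cut_neq0 z Hz)) as [l2 H2].
assert (H3 := is_derive_comp (K := C_AbsRing) (V := AbsRing_NormedModule C_AbsRing) Csqrt _ z l1 l2 H1 H2).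
assert (H4 := is_derive_mult (K := C_AbsRing) (fun z => z)
  (fun z => Csqrt (1 - / (z * z)))%C z _ _
  (is_derive_id z) H3 Cmult_comm).
eexists. split; [apply is_linear_scal_l | exact (proj2 H4)].
Qed.

Definition Cprod_range (F : nat -> C) (N0 n : nat) : C :=
  fold_right Cmult (RtoC 1) (map F (seq N0 (n - N0))).

Definition qprod (a b : Z -> R) (N0 n : nat) (z : C) : C :=
  Cprod_range (fun m => zeta (alpha a m * z + beta a b m))%C N0 n.

Definition Clim (u : nat -> C) (l : C) : Prop := filterlim u eventually (locally l).

Definition asymp_equiv (u v : nat -> C) : Prop :=
  exists eps : nat -> C,
    Clim eps 0%C /\ eventually (fun n => u n = v n * (1 + eps n))%C.

Definition is_Jost_solution (a b : Z -> R) (N0 : nat) (z : C) (f : Z -> C) : Prop :=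
  Jacobi_solution a b z f /\
  asymp_equiv (fun n : nat => f n) (fun n => / sqrt (a n) * qprod a b N0 n z)%C.

Definition is_orthogonal_polynomials (a b : Z -> R) (z : C) (P : Z -> C) : Prop :=
  Jacobi_solution a b z P /\ P (-1)%Z = 0%C /\ P 0%Z = 1%C.

Definition is_second_solution (a b : Z -> R) (N0 : nat) (z : C) (f g : Z -> C) : Prop :=
  Jacobi_solution a b z g /\
  forall n : nat, (N0 + 1 <= n)%nat ->
    g n = (f n * sum_n_m (fun m : nat => / (a (m - 1)%Z * f (m - 1)%Z * f m)) (N0 + 1) n)%C.

Definition compact_set (K : C -> Prop) : Prop :=
  forall (I : Type) (U : I -> C -> Prop),
    (forall i, open (U i)) ->
    (forall z, K z -> exists i, U i z) ->
    exists l : list I, forall z, K z -> exists i, In i l /\ U i z.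

Definition uniform_lim_on (K : C -> Prop) (u : nat -> C -> C) (l : C -> C) : Prop :=
  forall eps : R, 0 < eps ->
    eventually (fun n => forall z, K z -> Cmod (u n z - l z) < eps).

(* Main.v *)
Require Import Defs.
From Stdlib Require Import Reals ZArith List Lra Lia.
From Coquelicot Require Import Coquelicot.
Open Scope R_scope.

(** The rescaled sequence [w_n = sqrt (a_n) q_n P_n] satisfies, with [zeta_n^2 + 1 = 2 (alpha_n z + beta_n) zeta_n],
    [k_n (w_{n+1} - w_n) = zeta_n^2 (w_n - w_{n-1}) + (1 - k_n) w_n + zeta_n (zeta_n - zeta_{n-1}) w_{n-1}].
    Since [|zeta_n| <= 1/c < 1] and the last two coefficients are summable uniformly in [|z| < rho0], this is a
    summable perturbation of a contraction of the increments, so [w_n] is uniformly Cauchy on the whole disc.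
    The limit is identified pointwise: the identity
    [{P, f} = Omega] in the rescaled variables reads
    [zeta_n varkappa_n Omega = w_n zeta_n^2 (1 + o(1)) - w_{n+1} (1 + o(1))], and
    [1 - zeta^2 = 2 zeta sqrt (beta^2 - 1)].
    If [Omega = 0], then [{f, g} = 1] forces [P = {P, g} f], and [P_0 = 1] excludes [{P, g} = 0]. *)

(** * Limits of complex sequences *)

Lemma Clim_Cmod (u : nat -> C) (l : C) :
  Clim u l <-> forall eps, 0 < eps -> eventually (fun n => Cmod (u n - l) < eps).
Proof.
split; intros H.
- intros eps Heps.
  assert (Hs := Rlt_sqrt2_0).
  (* The balls of [C] as a product space are squares; the square of half-side [eps / sqrt 2] lies in
     the disc of radius [eps]. *)
  assert (Hd : 0 < eps / sqrt 2) by (apply Rdiv_lt_0_compat; assumption).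
  destruct (H _ (locally_ball l (mkposreal _ Hd))) as [N HN].
  exists N; intros n Hn.
  assert (B := C_NormedModule_mixin_compat2 _ _ _ (HN n Hn)).
  change (Cmod (u n - l) < sqrt 2 * (eps / sqrt 2)) in B.
  replace (sqrt 2 * (eps / sqrt 2)) with eps in B by (field; lra). exact B.
- intros Q [d Hd]. destruct (H d (cond_pos d)) as [N HN].
  exists N; intros n Hn. apply Hd, C_NormedModule_mixin_compat1, (HN n Hn).
Qed.

Lemma Clim_Re_Im (u : nat -> C) (l : C) :
  Clim u l <->
  is_lim_seq (fun n => Re (u n)) (Re l) /\ is_lim_seq (fun n => Im (u n)) (Im l).
Proof.
split.
- intros H. split; intros Q [d Hd];
    (destruct (H (fun y => ball l d y) (locally_ball l d)) as [N HN];
     exists N; intros n Hn; apply Hd, (HN n Hn)).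
- intros [H1 H2] Q [d Hd].
  destruct (H1 (fun y => ball (Re l) d y) (locally_ball _ d)) as [N1 HN1].
  destruct (H2 (fun y => ball (Im l) d y) (locally_ball _ d)) as [N2 HN2].
  exists (N1 + N2)%nat; intros n Hn. apply Hd. split.
  + apply HN1; lia.
  + apply HN2; lia.
Qed.

Lemma Clim_RtoC (u : nat -> R) (l : R) :
  is_lim_seq u l -> Clim (fun n => RtoC (u n)) l.
Proof.
intros H. apply Clim_Re_Im. split; [exact H | apply is_lim_seq_const].
Qed.

Lemma Clim_const (c : C) : Clim (fun _ => c) c.
Proof. apply Clim_Re_Im; split; apply is_lim_seq_const. Qed.

Lemma Clim_minus (u v : nat -> C) (l m : C) :
  Clim u l -> Clim v m -> Clim (fun n => u n - v n)%C (l - m)%C.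
Proof.
rewrite !Clim_Re_Im. intros [H1 H2] [H3 H4].
split; apply (is_lim_seq_minus' _ _ _ _); assumption.
Qed.

Lemma Clim_1_plus (u : nat -> C) : Clim u 0%C -> Clim (fun n => 1 + u n)%C 1%C.
Proof.
rewrite !Clim_Cmod. intros H eps Heps. destruct (H eps Heps) as [N HN].
exists N; intros n Hn.
replace (1 + u n - 1)%C with (u n - 0)%C by ring. exact (HN n Hn).
Qed.

Lemma Clim_mult (u v : nat -> C) (l m : C) :
  Clim u l -> Clim v m -> Clim (fun n => u n * v n)%C (l * m)%C.
Proof.
rewrite !Clim_Re_Im. intros [H1 H2] [H3 H4]. split.
- apply is_lim_seq_minus'; apply is_lim_seq_mult'; assumption.
- apply is_lim_seq_plus'; apply is_lim_seq_mult'; assumption.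
Qed.

Lemma Clim_ext_loc (u v : nat -> C) (l : C) :
  eventually (fun n => u n = v n) -> Clim u l -> Clim v l.
Proof. intros H. apply filterlim_ext_loc, H. Qed.

Lemma Clim_unique (u : nat -> C) (l m : C) : Clim u l -> Clim u m -> l = m.
Proof.
rewrite !Clim_Re_Im. intros [H1 H2] [H3 H4].
apply is_lim_seq_unique in H1, H2, H3, H4.
apply injective_projections; unfold Re, Im in *; congruence.
Qed.

Lemma Clim_incr_1 (u : nat -> C) (l : C) : Clim u l <-> Clim (fun n => u (S n)) l.
Proof.
rewrite !Clim_Re_Im. rewrite <- (is_lim_seq_incr_1 (fun n => Re (u n))).
rewrite <- (is_lim_seq_incr_1 (fun n => Im (u n))). reflexivity.
Qed.

(** * Uniformly Cauchy families and summable perturbations of contractions *)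

(** The parameter type is left general: the scalar sequence [varkappa] is the case [T = unit], the
    rescaled polynomials on a disc are the case [T = C]. *)
Definition unif_Cauchy_on {T : Type} (D : T -> Prop) (x : nat -> T -> C) : Prop :=
  forall eps, 0 < eps -> exists N, forall n m t, (N <= n)%nat -> (N <= m)%nat -> D t ->
    Cmod (x m t - x n t) < eps.

Lemma unif_Cauchy_on_Clim {T : Type} (D : T -> Prop) (x : nat -> T -> C) (t : T) :
  unif_Cauchy_on D x -> D t -> exists l, Clim (fun n => x n t) l.
Proof.
intros H Ht.
assert (H1 : ex_finite_lim_seq (fun n => Re (x n t))).
{ apply ex_lim_seq_cauchy_corr. intros eps.
  destruct (H eps (cond_pos eps)) as [N HN]. exists N; intros n m Hn Hm.
  eapply Rle_lt_trans; [| exact (HN m n t Hm Hn Ht)].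
  apply (re_le_Cmod (x n t - x m t)). }
assert (H2 : ex_finite_lim_seq (fun n => Im (x n t))).
{ apply ex_lim_seq_cauchy_corr. intros eps.
  destruct (H eps (cond_pos eps)) as [N HN]. exists N; intros n m Hn Hm.
  eapply Rle_lt_trans; [| exact (HN m n t Hm Hn Ht)].
  eapply Rle_trans; [| apply Rmax_Cmod]. apply Rmax_r. }
destruct H1 as [p Hp], H2 as [q Hq]. exists (p, q).
apply Clim_Re_Im; split; assumption.
Qed.

Lemma unif_Cauchy_on_uniform_lim (D : C -> Prop) (x : nat -> C -> C) (l : C -> C) :
  unif_Cauchy_on D x -> (forall z, D z -> Clim (fun n => x n z) (l z)) ->
  uniform_lim_on D x l.
Proof.
intros H Hl eps Heps.
destruct (H (eps / 2)) as [N HN]; [lra |].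
exists N; intros n Hn z Hz.
destruct (proj1 (Clim_Cmod _ _) (Hl z Hz) (eps / 2)) as [N2 HN2]; [lra |].
assert (H1 := HN (N + N2)%nat n z ltac:(lia) Hn Hz).
assert (H2 := HN2 (N + N2)%nat ltac:(lia)).
assert (H3 := Cmod_triangle (x n z - x (N + N2)%nat z) (x (N + N2)%nat z - l z)).
replace (x n z - x (N + N2)%nat z + (x (N + N2)%nat z - l z))%C with (x n z - l z)%C in H3 by ring.
lra.
Qed.

Lemma unif_Cauchy_on_shift {T : Type} (D : T -> Prop) (x : nat -> T -> C) (k : nat) :
  unif_Cauchy_on D (fun n => x (k + n)%nat) -> unif_Cauchy_on D x.
Proof.
intros H eps Heps. destruct (H eps Heps) as [N HN].
exists (k + N)%nat; intros n m t Hn Hm Ht.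
replace n with (k + (n - k))%nat by lia. replace m with (k + (m - k))%nat by lia.
apply HN; [lia | lia | exact Ht].
Qed.

Lemma ex_series_bounded (a : nat -> R) (M : R) :
  (forall n, 0 <= a n) -> (forall n, sum_n a n <= M) -> ex_series a.
Proof.
intros Ha HM.
destruct (ex_finite_lim_seq_incr (sum_n a) M) as [l Hl].
- intros n. rewrite sum_Sn. unfold plus; simpl. assert (H := Ha (S n)). lra.
- exact HM.
- exists l. exact Hl.
Qed.

Lemma sum_n_le_Series (a : nat -> R) (n : nat) :
  (forall n, 0 <= a n) -> ex_series a -> sum_n a n <= Series a.
Proof.
intros Ha H.
apply (is_lim_seq_incr_compare (sum_n a)).
- exact (Series_correct a H).
- intros k. rewrite sum_Sn. unfold plus; simpl. assert (T := Ha (S k)). lra.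
Qed.

(** The Weierstrass test applied to the telescoping series of increments. *)
Lemma unif_Cauchy_on_series {T : Type} (D : T -> Prop) (x : nat -> T -> C) (d : nat -> R) :
  ex_series d -> (forall n t, D t -> Cmod (x (S n) t - x n t) <= d n) ->
  unif_Cauchy_on D x.
Proof.
intros Hd Hx.
assert (Hsum : forall n k t, D t ->
  Cmod (x (S (n + k)) t - x n t) <= sum_n_m d n (n + k)).
{ intros n k t Ht. induction k as [| k IH].
  - rewrite Nat.add_0_r, sum_n_n. apply Hx, Ht.
  - rewrite Nat.add_succ_r, sum_n_Sm by lia.
    assert (H1 := Hx (S (n + k)) t Ht).
    assert (H2 := Cmod_triangle (x (S (S (n + k))) t - x (S (n + k)) t) (x (S (n + k)) t - x n t)).
    replace (x (S (S (n + k))) t - x (S (n + k)) t + (x (S (n + k)) t - x n t))%C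
      with (x (S (S (n + k))) t - x n t)%C in H2 by ring.
    unfold plus; simpl. lra. }
intros eps Heps.
destruct (Cauchy_ex_series d Hd (mkposreal eps Heps)) as [N HN].
assert (Hlt : forall n m t, (N <= n)%nat -> (n < m)%nat -> D t -> Cmod (x m t - x n t) < eps).
{ intros n m t Hn Hm Ht.
  replace m with (S (n + (m - S n))) by lia.
  eapply Rle_lt_trans; [apply Hsum, Ht |].
  apply (Rle_lt_trans _ (Rabs (sum_n_m d n (n + (m - S n))))); [apply Rle_abs |].
  apply HN; lia. }
exists N; intros n m t Hn Hm Ht.
destruct (Nat.lt_trichotomy n m) as [H | [-> | H]].
- apply Hlt; assumption.
- rewrite (Cplus_opp_r (x m t) : (x m t - x m t = 0)%C), Cmod_0. exact Heps.
- replace (x m t - x n t)%C with (- (x n t - x m t))%C by ring.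
  rewrite Cmod_opp. apply Hlt; assumption.
Qed.

(** Two passes through the recursion. First, the function [L] grows at step [n] by a factor at most
    [exp (2 (1 + c) e_n)], so summability of [e] bounds all [x n t] by a constant [B] uniform in
    [t]. Then, with this bound inserted, the increments are dominated by the scalar recursion [d],
    which is summable because [r < 1]. *)
Lemma perturbed_contraction_Cauchy {T : Type} (D : T -> Prop) (x : nat -> T -> C)
    (r M : R) (e : nat -> R) :
  0 <= r < 1 -> (forall n, 0 <= e n) -> ex_series e ->
  (forall t, D t -> Cmod (x 0%nat t) <= M) -> (forall t, D t -> Cmod (x 1%nat t) <= M) ->
  (forall n t, D t -> Cmod (x (S (S n)) t - x (S n) t) <=
     r * Cmod (x (S n) t - x n t) + e n * (Cmod (x (S n) t) + Cmod (x n t))) ->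
  unif_Cauchy_on D x.
Proof.
intros Hr He Hse H0 H1 Hrec.
set (c := / (1 - r)).
assert (Hc : c * (1 - r) = 1) by (unfold c; field; lra).
assert (Hc1 : 1 <= c) by nra.
(* Lyapunov function of the recursion: the weight [c] solves [(1 + c) r <= c]. *)
set (L := fun n t => Cmod (x (S n) t) + c * Cmod (x (S n) t - x n t)).
set (E := Series e).
assert (HL : forall n t, D t -> L (S n) t <= L n t * exp (2 * (1 + c) * e n)).
{ intros n t Ht. unfold L.
  assert (R1 := Hrec n t Ht).
  set (d := Cmod (x (S n) t - x n t)) in *.
  set (d' := Cmod (x (S (S n)) t - x (S n) t)) in *.
  assert (T1 := Cmod_triangle (x (S (S n)) t - x (S n) t) (x (S n) t)).
  replace (x (S (S n)) t - x (S n) t + x (S n) t)%C with (x (S (S n)) t) in T1 by ring.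
  assert (T2 := Cmod_triangle (x (S n) t) (- (x (S n) t - x n t))).
  replace (x (S n) t + - (x (S n) t - x n t))%C with (x n t) in T2 by ring.
  rewrite Cmod_opp in T2. fold d in T2. fold d' in T1.
  assert (P1 := Cmod_ge_0 (x (S n) t)). assert (P2 : 0 <= d) by apply Cmod_ge_0.
  set (X := Cmod (x (S n) t)) in *. set (Y := Cmod (x n t)) in *.
  assert (Hen := He n).
  (* [L (S n) t] is at most [X + (1 + c) d'], and [X + Y <= 2 (X + c d)] because [Y <= X + d] and
     [c >= 1]. This is the origin of the constant [2 (1 + c)]. *)
  assert (Hlin : Cmod (x (S (S n)) t) + c * d' <= (X + c * d) * (1 + 2 * (1 + c) * e n)).
  { assert (S1 : e n * (X + Y) <= e n * (2 * (X + c * d))).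
    { apply Rmult_le_compat_l; [exact Hen | nra]. }
    assert (S2 : (1 + c) * d' <= (1 + c) * (r * d + e n * (2 * (X + c * d))))
      by (apply Rmult_le_compat_l; lra).
    assert (S3 : (1 + c) * r * d <= c * d) by (apply Rmult_le_compat_r; nra).
    lra. }
  eapply Rle_trans; [exact Hlin |].
  apply Rmult_le_compat_l; [nra | apply exp_ineq1_le]. }
set (L0 := M + c * (2 * M)).
assert (HL0 : forall t, D t -> L 0%nat t <= L0).
{ intros t Ht. unfold L, L0.
  assert (T1 := Cmod_triangle (x 1%nat t) (- x 0%nat t)). rewrite Cmod_opp in T1.
  replace (x 1%nat t + - x 0%nat t)%C with (x 1%nat t - x 0%nat t)%C in T1 by ring.
  assert (A := H0 t Ht). assert (B := H1 t Ht).
  assert (c * Cmod (x 1%nat t - x 0%nat t) <= c * (2 * M))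
    by (apply Rmult_le_compat_l; lra).
  lra. }
assert (HLn : forall n t, D t -> L (S n) t <= L0 * exp (2 * (1 + c) * sum_n e n)).
{ intros n t Ht. induction n as [| n IH].
  - rewrite sum_O. eapply Rle_trans; [apply HL, Ht |].
    apply Rmult_le_compat_r; [left; apply exp_pos | apply HL0, Ht].
  - rewrite sum_Sn. unfold plus; simpl.
    rewrite Rmult_plus_distr_l, exp_plus, <- Rmult_assoc.
    eapply Rle_trans; [apply HL, Ht |].
    apply Rmult_le_compat_r; [left; apply exp_pos | exact IH]. }
(* The absolute value keeps [B] nonnegative even if [D] is empty, when nothing fixes the sign of
   [M]. *)
set (B := Rabs L0 * exp (2 * (1 + c) * E)).
assert (HB : forall n t, D t -> L n t <= B).
{ intros n t Ht.
  assert (HE : 1 <= exp (2 * (1 + c) * E)).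
  { assert (HE0 := sum_n_le_Series e 0 He Hse). rewrite sum_O in HE0. fold E in HE0.
    assert (T1 := exp_ineq1_le (2 * (1 + c) * E)). assert (T2 := He 0%nat).
    assert (0 <= (1 + c) * E) by (apply Rmult_le_pos; lra). lra. }
  assert (HA := Rle_abs L0). assert (HA0 := Rabs_pos L0).
  destruct n as [| n].
  - assert (T1 := HL0 t Ht). unfold B. nra.
  - eapply Rle_trans; [apply HLn, Ht |].
    apply Rle_trans with (Rabs L0 * exp (2 * (1 + c) * sum_n e n)).
    + apply Rmult_le_compat_r; [left; apply exp_pos | exact HA].
    + apply Rmult_le_compat_l; [exact HA0 |].
      assert (T1 := sum_n_le_Series e n He Hse). fold E in T1.
      destruct (Rle_lt_or_eq_dec _ _ T1) as [T2 | ->]; [left | right; reflexivity].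
      apply exp_increasing, Rmult_lt_compat_l; lra. }
assert (HB0 : 0 <= B) by (apply Rmult_le_pos; [apply Rabs_pos | left; apply exp_pos]).
(* Majorant of the increments: the assumed recursion with [|x_{n+1}| + |x_n|] replaced by its bound
   [2 B]. *)
set (d := fix d (n : nat) : R := match n with
  | O => B
  | S k => r * d k + e k * (2 * B) end).
assert (Hd0 : forall n, 0 <= d n).
{ induction n as [| n IH]; simpl; [exact HB0 |].
  apply Rplus_le_le_0_compat; apply Rmult_le_pos; try lra; try exact IH; apply He. }
assert (Hxd : forall n t, D t -> Cmod (x (S n) t - x n t) <= d n).
{ intros n t Ht.
  assert (Q : forall k, Cmod (x (S k) t - x k t) <= B /\ Cmod (x (S k) t) <= B
     /\ Cmod (x (S k) t) + Cmod (x k t) <= 2 * B).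
  { intros k. assert (H := HB k t Ht). unfold L in H.
    assert (A1 := Cmod_ge_0 (x (S k) t)). assert (A2 := Cmod_ge_0 (x (S k) t - x k t)).
    assert (T2 := Cmod_triangle (x (S k) t) (- (x (S k) t - x k t))).
    replace (x (S k) t + - (x (S k) t - x k t))%C with (x k t) in T2 by ring.
    rewrite Cmod_opp in T2.
    repeat split; nra. }
  induction n as [| n IH]; simpl; [apply Q |].
  eapply Rle_trans; [apply Hrec, Ht |].
  apply Rplus_le_compat.
  - apply Rmult_le_compat_l; [lra | exact IH].
  - apply Rmult_le_compat_l; [apply He | apply Q]. }
apply (unif_Cauchy_on_series D x d); [| exact Hxd].
apply (ex_series_bounded d (c * (B + 2 * B * E))); [exact Hd0 |].
intros n.
(* The recursion for [d] summed exactly and multiplied by [c = 1 / (1 - r)]. The last two terms on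
   the left are nonnegative, so dropping them bounds the partial sums. *)
assert (Hs : sum_n d n + c * r * d n + c * (2 * B * e n) = c * (B + 2 * B * sum_n e n)).
{ assert (Hcr : c * r = c - 1) by lra.
  induction n as [| n IH].
  - rewrite !sum_O, Hcr. simpl. ring.
  - rewrite !sum_Sn. unfold plus; simpl. rewrite Hcr in *.
    transitivity (sum_n d n + (c - 1) * d n + c * (2 * B * e n) + c * (2 * B * e (S n))
      + (c * r - (c - 1)) * d n); [ring |].
    rewrite IH, Hcr. ring. }
assert (Hle := sum_n_le_Series e n He Hse). fold E in Hle.
assert (A1 := He n). assert (A2 := Hd0 n).
assert (0 <= c * r * d n) by (repeat apply Rmult_le_pos; lra).
assert (0 <= B * e n) by (apply Rmult_le_pos; lra).
assert (0 <= c * (2 * B * e n)) by (apply Rmult_le_pos; lra).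
assert (c * (B + 2 * B * sum_n e n) <= c * (B + 2 * B * E)).
{ apply Rmult_le_compat_l; [lra |]. apply Rplus_le_compat_l, Rmult_le_compat_l; lra. }
lra.
Qed.

(** * The function [zeta] outside the cut *)

Lemma Cmod_gt1_not_cut (w : C) : 1 < Cmod w -> ~ in_cut w.
Proof.
intros H [Hi Hr]. assert (Hm := Cmod_sqr w). rewrite Hi in Hm. nra.
Qed.

(** The roots of [t^2 - 2 w t + 1] are [w - sqrt (w^2 - 1)] and [w + sqrt (w^2 - 1)]. Most later
    facts on [zeta] are drawn from this equation, without returning to the formula for the root. *)
Lemma zeta_quadratic (w : C) :
  ~ in_cut w -> (zeta w * zeta w + 1 = 2 * w * zeta w)%C.
Proof.
intros Hw. unfold zeta. assert (H := Csqrt_sq1_sqr w Hw).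
set (s := Csqrt_sq1 w) in *.
transitivity (w * w - 2 * w * s + s * s + 1)%C; [ring |]. rewrite H. ring.
Qed.

Lemma zeta_neq0 (w : C) : ~ in_cut w -> zeta w <> 0%C.
Proof.
intros Hw E. assert (H := zeta_quadratic w Hw). rewrite E in H.
rewrite !Cmult_0_r, Cplus_0_l in H. injection H. lra.
Qed.

(** The two roots are [zeta] and [1 / zeta], and they differ by twice the square root. This produces
    the denominator of the limit. *)
Lemma Csqrt_sq1_zeta (w : C) :
  ~ in_cut w -> (1 - zeta w * zeta w = zeta w * (2 * Csqrt_sq1 w))%C.
Proof.
intros Hw. unfold zeta. assert (H := Csqrt_sq1_sqr w Hw).
set (s := Csqrt_sq1 w) in *.
transitivity (1 - w * w + 2 * w * s - s * s)%C; [ring |].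
transitivity (2 * w * s - 2 * (s * s))%C; [rewrite H; ring | ring].
Qed.

(* The factor [Csqrt (1 - 1/w^2)] has nonnegative real part, so [zeta w] is the
   smaller of the two roots, whose product is 1. *)
Lemma Cmod_zeta_le1 (w : C) : ~ in_cut w -> Cmod (zeta w) <= 1.
Proof.
intros Hw. assert (Hq := zeta_quadratic w Hw). revert Hq.
unfold zeta, Csqrt_sq1.
set (s := Csqrt (1 - / (w * w))). intros Hq.
assert (Hs : 0 <= Re s) by apply Csqrt_Re_ge0.
assert (H1 : Cmod (w - w * s) <= Cmod (w + w * s)).
{ replace (w - w * s)%C with (w * (1 - s))%C by ring.
  replace (w + w * s)%C with (w * (1 + s))%C by ring.
  rewrite !Cmod_mult. apply Rmult_le_compat_l; [apply Cmod_ge_0 |].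
  assert (A := Cmod_sqr (1 - s)). assert (B := Cmod_sqr (1 + s)).
  assert (A0 := Cmod_ge_0 (1 - s)). assert (B0 := Cmod_ge_0 (1 + s)).
  assert (Cmod (1 - s) * Cmod (1 - s) <= Cmod (1 + s) * Cmod (1 + s)).
  { rewrite A, B. destruct s as [x y]. unfold Re, Im in *. simpl in *. nra. }
  nra. }
assert (H2 : ((w - w * s) * (w + w * s) = 1)%C).
{ transitivity (2 * w * (w - w * s) - (w - w * s) * (w - w * s))%C; [ring |].
  rewrite <- Hq. ring. }
apply (f_equal Cmod) in H2. rewrite Cmod_mult, Cmod_1 in H2.
assert (A0 := Cmod_ge_0 (w - w * s)). nra.
Qed.

(** Moduli in the quadratic equation give [2 |w| |zeta w| <= |zeta w|^2 + 1 <= 2]. *)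
Lemma Cmod_zeta_le_inv (w : C) (c : R) : 1 < c -> c <= Cmod w -> Cmod (zeta w) <= / c.
Proof.
intros Hc Hw.
assert (Hcut : ~ in_cut w) by (apply Cmod_gt1_not_cut; lra).
assert (H1 := Cmod_zeta_le1 w Hcut).
assert (Hq := f_equal Cmod (zeta_quadratic w Hcut)).
rewrite !Cmod_mult, Cmod_R, (Rabs_pos_eq 2) in Hq by lra.
assert (Ht := Cmod_triangle (zeta w * zeta w) 1). rewrite Cmod_1, Cmod_mult in Ht.
assert (H0 := Cmod_ge_0 (zeta w)). set (t := Cmod (zeta w)) in *.
apply Rmult_le_reg_l with c; [lra |]. rewrite Rinv_r by lra.
assert (c * t <= Cmod w * t) by (apply Rmult_le_compat_r; lra). nra.
Qed.

(** Eliminating between the quadratic equations of [x = zeta w] and [y = zeta v] gives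
    [(x - y) (1 - x y) = - 2 (w - v) x y], where [|x y| <= 1 / c^2]. *)
Lemma zeta_Lipschitz (w v : C) (c : R) : 1 < c -> c <= Cmod w -> c <= Cmod v ->
  Cmod (zeta w - zeta v) <= 2 / (c * c - 1) * Cmod (w - v).
Proof.
intros Hc Hw Hv.
assert (Qw := zeta_quadratic w (Cmod_gt1_not_cut w ltac:(lra))).
assert (Qv := zeta_quadratic v (Cmod_gt1_not_cut v ltac:(lra))).
assert (Bw := Cmod_zeta_le_inv w c Hc Hw). assert (Bv := Cmod_zeta_le_inv v c Hc Hv).
set (x := zeta w) in *. set (y := zeta v) in *.
assert (Hxy : Cmod (x * y) <= / (c * c)).
{ rewrite Cmod_mult, Rinv_mult.
  apply Rmult_le_compat; try apply Cmod_ge_0; assumption. }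
assert (E : (x - y = (x - y) * (x * y) - 2 * (w - v) * (x * y))%C).
{ transitivity ((x - y) * (x * y) - ((x * x + 1) * y - (y * y + 1) * x))%C; [ring |].
  rewrite Qw, Qv. ring. }
assert (H := Cmod_triangle ((x - y) * (x * y)) (- (2 * (w - v) * (x * y)))).
replace ((x - y) * (x * y) + - (2 * (w - v) * (x * y)))%C with (x - y)%C in H by exact E.
rewrite Cmod_opp, (Cmod_mult (x - y)), (Cmod_mult (2 * (w - v))), (Cmod_mult 2), Cmod_R,
  (Rabs_pos_eq 2) in H by lra.
assert (P1 := Cmod_ge_0 (x - y)). assert (P2 := Cmod_ge_0 (w - v)).
assert (Hc2 : 1 < c * c) by nra.
set (d := Cmod (x - y)) in *. set (p := Cmod (x * y)) in *. set (q := Cmod (w - v)) in *.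
assert (H2 : d <= d * / (c * c) + 2 * q * / (c * c)).
{ eapply Rle_trans; [exact H |].
  apply Rplus_le_compat; apply Rmult_le_compat_l; lra. }
apply Rmult_le_compat_l with (r := c * c) in H2; [| lra].
replace (c * c * (d * / (c * c) + 2 * q * / (c * c))) with (d + 2 * q) in H2
  by (field; lra).
apply Rmult_le_reg_l with (c * c - 1); [lra |].
replace ((c * c - 1) * (2 / (c * c - 1) * q)) with (2 * q) by (field; lra). lra.
Qed.

(** * Recurrence and Wronskian in rescaled variables *)

(** [fold_right] exposes the first factor, whereas the recurrences need the last one; hence the
    induction on the length with the starting index kept general. *)
Lemma Cprod_range_Sr (F : nat -> C) (N n : nat) : (N <= n)%nat ->
  Cprod_range F N (S n) = (Cprod_range F N n * F n)%C.
Proof.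
intros H. unfold Cprod_range. rewrite Nat.sub_succ_l by exact H.
replace (F n) with (F (N + (n - N))%nat) by (f_equal; lia).
generalize (n - N)%nat as k; clear H n; intros k. revert N.
induction k as [| k IH]; intros N.
- simpl. rewrite Nat.add_0_r. ring.
- change (F N * fold_right Cmult 1 (map F (seq (S N) (S k)))
    = F N * fold_right Cmult 1 (map F (seq (S N) k)) * F (N + S k)%nat)%C.
  rewrite IH. replace (S N + k)%nat with (N + S k)%nat by lia. ring.
Qed.

(** This is the Jacobi equation divided by [sqrt (a_{n-1})]. For [sqrt (a_n) u_n] the growing
    coefficients disappear, and what remains depends only on [k_n], [alpha_n] and [beta_n]. *)
Lemma scaled_recurrence (a b : Z -> R) (z : C) (u : Z -> C) :
  (forall n : Z, (-1 <= n)%Z -> 0 < a n) -> Jacobi_solution a b z u ->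
  forall n : Z, (0 <= n)%Z ->
  (kratio a n * (sqrt (a (n + 1)%Z) * u (n + 1)%Z) + sqrt (a (n - 1)%Z) * u (n - 1)%Z
   = 2 * (alpha a n * z + beta a b n) * (sqrt (a n) * u n))%C.
Proof.
intros Ha Hu n Hn.
assert (E := Hu n Hn).
assert (A0 := Ha (n - 1)%Z ltac:(lia)). assert (A1 := Ha n ltac:(lia)).
assert (A2 := Ha (n + 1)%Z ltac:(lia)).
unfold kratio, varkappa, alpha, beta.
replace (n - 1 + 1)%Z with n by lia.
rewrite sqrt_mult, !sqrt_div by lra.
rewrite <- (sqrt_sqrt (a n)), <- (sqrt_sqrt (a (n - 1)%Z)) in E by lra.
assert (S0 := sqrt_lt_R0 _ A0). assert (S1 := sqrt_lt_R0 _ A1).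
assert (S2 := sqrt_lt_R0 _ A2).
set (s0 := sqrt (a (n - 1)%Z)) in *. set (s1 := sqrt (a n)) in *.
set (s2 := sqrt (a (n + 1)%Z)) in *.
replace (s1 / s0 / (s2 / s1)) with (s1 * s1 / (s0 * s2)) by (field; lra).
assert (C0 : RtoC s0 <> 0%C) by (intros F; injection F; lra).
assert (C1 : RtoC s1 <> 0%C) by (intros F; injection F; lra).
assert (C2 : RtoC s2 <> 0%C) by (intros F; injection F; lra).
unfold Rdiv. rewrite !Rinv_mult, !RtoC_opp, !RtoC_mult, !RtoC_inv by lra.
rewrite !RtoC_mult in E.
assert (E2 : (s1 * s1 * u (n + 1)%Z = z * u n - b n * u n - s0 * s0 * u (n - 1)%Z)%C)
  by (rewrite <- E; ring).
transitivity (/ s0 * (s1 * s1 * u (n + 1)%Z) + s0 * u (n - 1)%Z)%C; [field; tauto |].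
rewrite E2. field. tauto.
Qed.

(** Holds because [varkappa_n a_n = sqrt (a_n a_{n+1})]; this is where [varkappa] enters the
    limit. *)
Lemma scaled_Wronskian (a : Z -> R) (u v : Z -> C) (n : Z) :
  0 < a n -> 0 < a (n + 1)%Z ->
  (varkappa a n * Wronskian_at a u v n
   = sqrt (a n) * u n * (sqrt (a (n + 1)%Z) * v (n + 1)%Z)
     - sqrt (a (n + 1)%Z) * u (n + 1)%Z * (sqrt (a n) * v n))%C.
Proof.
intros A0 A1. unfold varkappa, Wronskian_at.
rewrite sqrt_div by lra. rewrite <- (sqrt_sqrt (a n)) at 2 by lra.
assert (S0 := sqrt_lt_R0 _ A0).
assert (C0 : RtoC (sqrt (a n)) <> 0%C) by (intros F; injection F; lra).
unfold Rdiv. rewrite !RtoC_mult, RtoC_inv by lra. field. exact C0.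
Qed.

(** The rescaled recurrence at [n + 1] is multiplied by [q_{n+2} = q_n ze_n ze_{n+1}], and the
    quadratic equation turns its right-hand coefficient into [ze_{n+1}^2 + 1]. The terms are grouped
    so that with [k = 1] and constant [ze] only the contraction of increments by [ze^2] survives. *)
Lemma scaled_product_recurrence (a b : Z -> R) (N0 n : nat) (z : C) (u : Z -> C) :
  (forall n : Z, (-1 <= n)%Z -> 0 < a n) -> Jacobi_solution a b z u ->
  (N0 <= n)%nat -> ~ in_cut (alpha a (S n) * z + beta a b (S n))%C ->
  let w (m : nat) := (sqrt (a m) * qprod a b N0 m z * u m)%C in
  let ze (m : nat) := zeta (alpha a m * z + beta a b m)%C in
  (kratio a (S n) * (w (S (S n)) - w (S n))
   = ze (S n) * ze (S n) * (w (S n) - w n) + (1 - kratio a (S n)) * w (S n)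
     + ze (S n) * (ze (S n) - ze n) * w n)%C.
Proof.
intros Ha Hu Hn Hcut w ze.
assert (Hq := zeta_quadratic _ Hcut). fold (ze (S n)) in Hq.
assert (E := scaled_recurrence a b z u Ha Hu (S n) ltac:(lia)).
replace (Z.of_nat (S n) + 1)%Z with (Z.of_nat (S (S n))) in E by lia.
replace (Z.of_nat (S n) - 1)%Z with (Z.of_nat n) in E by lia.
unfold w, qprod. rewrite !Cprod_range_Sr by lia. fold (ze n) (ze (S n)).
set (q := Cprod_range _ N0 n).
set (k := RtoC (kratio a (S n))) in *.
set (p0 := (sqrt (a n) * u n)%C) in *.
set (p1 := (sqrt (a (S n)) * u (S n))%C) in *.
set (p2 := (sqrt (a (S (S n))) * u (S (S n)))%C) in *.
set (g := (alpha a (S n) * z + beta a b (S n))%C) in *.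
transitivity (q * ze n * ze (S n) * (k * p2 + p0) - q * ze n * ze (S n) * p0
  - q * ze n * k * p1)%C; [unfold p0, p1, p2; ring |].
rewrite E.
transitivity (q * ze n * (2 * g * ze (S n)) * p1 - q * ze n * ze (S n) * p0
  - q * ze n * k * p1)%C; [ring |].
rewrite <- Hq. unfold p0, p1. ring.
Qed.

(** * Convergence of [varkappa] and of the rescaled polynomials *)

(** From [varkappa_n = k_{n+1} varkappa_{n+1}] the increments are [- (k_{n+1} - 1) varkappa_{n+1}]:
    a perturbed contraction with [r = 0] and a one-point parameter set. *)
Lemma varkappa_is_lim (a : Z -> R) :
  (forall n : Z, (-1 <= n)%Z -> 0 < a n) -> ell1 (fun n => kratio a n - 1) ->
  is_lim_seq (fun n : nat => varkappa a n) (varkappa_inf a).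
Proof.
intros Ha Hk.
assert (Hpos : forall n : Z, (-1 <= n)%Z -> 0 < varkappa a n).
{ intros n Hn. apply sqrt_lt_R0, Rdiv_lt_0_compat; apply Ha; lia. }
destruct (proj2 (is_lim_seq_spec _ _) (ex_series_lim_0 _ Hk) (mkposreal (/ 2) ltac:(lra))) as [N HN].
(* With [k >= 1/2] each [varkappa] is at most twice the preceding one; this is the factor 2 in the
   perturbation used below. *)
assert (Hk2 : forall n : nat, (N <= n)%nat -> / 2 <= kratio a n).
{ intros n Hn. assert (H := HN n Hn). simpl in H.
  rewrite Rminus_0_r, Rabs_Rabsolu in H. apply Rabs_def2 in H. lra. }
assert (HC : unif_Cauchy_on (fun _ : unit => True) (fun n _ => RtoC (varkappa a n))).
{ apply (unif_Cauchy_on_shift _ _ N).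
  apply (perturbed_contraction_Cauchy _ _ 0 (varkappa a N + varkappa a (S N))
    (fun n => 2 * Rabs (kratio a (2 + N + n)%nat - 1))).
  - lra.
  - intros n. assert (H := Rabs_pos (kratio a (2 + N + n)%nat - 1)). lra.
  - apply (ex_series_scal (V := R_NormedModule) 2
      (fun n => Rabs (kratio a (2 + N + n)%nat - 1))).
    apply (ex_series_incr_n (fun n : nat => Rabs (kratio a n - 1)) (2 + N)), Hk.
  - intros _ _. rewrite Nat.add_0_r, Cmod_R, Rabs_pos_eq by (left; apply Hpos; lia).
    assert (H := Hpos (S N) ltac:(lia)). lra.
  - intros _ _. rewrite Nat.add_1_r, Cmod_R, Rabs_pos_eq by (left; apply Hpos; lia).
    assert (H := Hpos N ltac:(lia)). lra.
  - intros n _ _. rewrite !Nat.add_succ_r, Rmult_0_l, Rplus_0_l. simpl Nat.add.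
    set (m := (N + n)%nat).
    rewrite <- !RtoC_minus, !Cmod_R.
    assert (P1 := Hpos (S m) ltac:(lia)). assert (P2 := Hpos (S (S m)) ltac:(lia)).
    assert (K2 := Hk2 (S (S m)) ltac:(lia)).
    assert (E1 : varkappa a (S m) = kratio a (S (S m)) * varkappa a (S (S m))).
    { unfold kratio. replace (Z.of_nat (S (S m)) - 1)%Z with (Z.of_nat (S m)) by lia.
      field. lra. }
    replace (varkappa a (S (S m)) - varkappa a (S m))
      with (- ((kratio a (S (S m)) - 1) * varkappa a (S (S m)))) by (rewrite E1; ring).
    rewrite Rabs_Ropp, Rabs_mult, (Rabs_pos_eq (varkappa a (S (S m)))),
      (Rabs_pos_eq (varkappa a (S m))) by lra.
    assert (Q := Rabs_pos (kratio a (S (S m)) - 1)).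
    assert (Q0 := Rabs_pos (varkappa a m)).
    assert (varkappa a (S (S m)) <= 2 * (varkappa a (S m) + Rabs (varkappa a m))) by nra.
    nra. }
destruct (unif_Cauchy_on_Clim _ _ tt HC I) as [l Hl].
apply Clim_Re_Im in Hl. destruct Hl as [Hl _].
change (is_lim_seq (fun n : nat => varkappa a n) (Re l)) in Hl.
unfold varkappa_inf. rewrite (is_lim_seq_unique _ _ Hl). exact Hl.
Qed.

(** Provides the bounds on the two starting values, uniform in the disc, that
    [perturbed_contraction_Cauchy] requires. *)
Lemma orthogonal_polynomials_bounded (a b : Z -> R) (P : C -> Z -> C) (rho : R) :
  (forall n : Z, (-1 <= n)%Z -> 0 < a n) ->
  (forall z, is_orthogonal_polynomials a b z (P z)) ->
  forall n : nat, exists M, forall z, Cmod z < rho -> Cmod (P z n) <= M.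
Proof.
intros Ha HP n.
(* The recurrence has order two, so the induction carries two consecutive indices, starting from -1
   and 0. *)
enough (H : exists M, forall z, Cmod z < rho ->
  Cmod (P z (n - 1)%Z) <= M /\ Cmod (P z n) <= M).
{ destruct H as [M HM]. exists M. intros z Hz. apply HM, Hz. }
induction n as [| n [M IH]].
- exists 1. intros z _. destruct (HP z) as [_ [H1 H2]].
  change (Cmod (P z (-1)%Z) <= 1 /\ Cmod (P z 0%Z) <= 1).
  rewrite H1, H2, Cmod_0, Cmod_1. lra.
- assert (A0 := Ha (n - 1)%Z ltac:(lia)). assert (A1 := Ha n ltac:(lia)).
  exists (Rmax M (/ a n * ((rho + Rabs (b n)) * M + a (n - 1)%Z * M))).
  intros z Hz. destruct (IH z Hz) as [I0 I1].
  replace (Z.of_nat (S n) - 1)%Z with (Z.of_nat n) by lia.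
  split; [eapply Rle_trans; [exact I1 | apply Rmax_l] |].
  eapply Rle_trans; [| apply Rmax_r].
  assert (E := proj1 (HP z) n ltac:(lia)).
  replace (Z.of_nat n + 1)%Z with (Z.of_nat (S n)) in E by lia.
  assert (E2 : (a n * P z (S n)
    = (z - b n) * P z n + - (a (n - 1)%Z * P z (n - 1)%Z))%C).
  { transitivity (a (n - 1)%Z * P z (n - 1)%Z + b n * P z n + a n * P z (S n)
      - b n * P z n - a (n - 1)%Z * P z (n - 1)%Z)%C; [ring |].
    rewrite E. ring. }
  apply (f_equal Cmod) in E2. rewrite Cmod_mult, Cmod_R, (Rabs_pos_eq (a n)) in E2 by lra.
  assert (T1 := Cmod_triangle ((z - b n) * P z n) (- (a (n - 1)%Z * P z (n - 1)%Z))).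
  rewrite Cmod_opp, !Cmod_mult, Cmod_R, (Rabs_pos_eq (a (n - 1)%Z)) in T1 by lra.
  assert (T2 := Cmod_triangle z (- b n)%C). rewrite Cmod_opp, Cmod_R in T2.
  apply Rmult_le_reg_l with (a n); [exact A1 |].
  rewrite <- Rmult_assoc, Rinv_r, Rmult_1_l by lra.
  rewrite E2. eapply Rle_trans; [exact T1 |].
  apply Rplus_le_compat; [| apply Rmult_le_compat_l; lra].
  apply Rmult_le_compat; try apply Cmod_ge_0; [| exact I1].
  change (Cmod (z + - b n) <= rho + Rabs (b n)). lra.
Qed.

Lemma qprod_le1 (a b : Z -> R) (N0 : nat) (z : C) :
  (forall n : nat, (N0 <= n)%nat -> ~ in_cut (alpha a n * z + beta a b n)%C) ->
  forall n : nat, (N0 <= n)%nat -> Cmod (qprod a b N0 n z) <= 1.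
Proof.
intros H n Hn. induction Hn as [| n Hn IH].
- unfold qprod, Cprod_range. rewrite Nat.sub_diag. simpl. rewrite Cmod_1. lra.
- unfold qprod. rewrite Cprod_range_Sr by exact Hn. rewrite Cmod_mult, <- (Rmult_1_l 1).
  apply Rmult_le_compat; try apply Cmod_ge_0; [exact IH | apply Cmod_zeta_le1, H, Hn].
Qed.

Lemma qprod_neq0 (a b : Z -> R) (N0 : nat) (z : C) :
  (forall n : nat, (N0 <= n)%nat -> ~ in_cut (alpha a n * z + beta a b n)%C) ->
  forall n : nat, (N0 <= n)%nat -> qprod a b N0 n z <> 0%C.
Proof.
intros H n Hn. induction Hn as [| n Hn IH].
- unfold qprod, Cprod_range. rewrite Nat.sub_diag. simpl. intros E; injection E; lra.
- unfold qprod. rewrite Cprod_range_Sr by exact Hn.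
  apply Cmult_neq_0; [exact IH | apply zeta_neq0, H, Hn].
Qed.

(** The lower bound [c] on [|alpha_n z + beta_n|] gives both the contraction, through
    [|zeta|^2 <= r = 1 / c^2], and a Lipschitz bound that makes the increments of [zeta] summable
    uniformly in the disc. *)
Lemma scaled_P_unif_Cauchy (a b : Z -> R) (P : C -> Z -> C) (rho c : R) (N0 : nat) :
  (forall n : Z, (-1 <= n)%Z -> 0 < a n) ->
  (forall z, is_orthogonal_polynomials a b z (P z)) ->
  ell1 (diff (alpha a)) -> ell1 (diff (beta a b)) -> ell1 (fun n => kratio a n - 1) ->
  0 < rho -> 1 < c ->
  (forall (n : nat) (z : C), (N0 <= n)%nat -> Cmod z < rho ->
     c <= Cmod (alpha a n * z + beta a b n)) ->
  unif_Cauchy_on (fun z => Cmod z < rho)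
    (fun n z => sqrt (a n) * qprod a b N0 n z * P z n)%C.
Proof.
intros Ha HP Hal Hbe Hk Hrho Hc Hg.
set (x := fun (n : nat) z => (sqrt (a n) * qprod a b N0 n z * P z n)%C).
set (r := / c * / c).
assert (Hic : 0 < / c < 1).
{ split; [apply Rinv_0_lt_compat; lra |].
  rewrite <- Rinv_1. apply Rinv_lt_contravar; lra. }
assert (Hr : 0 <= r < 1) by (unfold r; nra).
(* The tolerance [(1 - r) / 2] places [k_n] above the midpoint of [r] and 1, so the factor stays
   below 1 after division by [k_n]. *)
destruct (proj2 (is_lim_seq_spec _ _) (ex_series_lim_0 _ Hk) (mkposreal ((1 - r) / 2) ltac:(lra)))
  as [N1 HN1].
assert (Hk2 : forall n : nat, (N1 <= n)%nat -> (1 + r) / 2 <= kratio a n).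
{ intros n Hn. assert (H := HN1 n Hn). simpl in H.
  rewrite Rminus_0_r, Rabs_Rabsolu in H. apply Rabs_def2 in H. lra. }
set (N := (N0 + N1)%nat).
set (K := 2 / (c * c - 1)).
assert (HK : 0 < K) by (apply Rdiv_lt_0_compat; nra).
assert (Hbd : forall n, (N0 <= n)%nat -> exists M, forall z, Cmod z < rho -> Cmod (x n z) <= M).
{ intros n Hn. destruct (orthogonal_polynomials_bounded a b P rho Ha HP n) as [M HM].
  exists (sqrt (a n) * 1 * M). intros z Hz. unfold x. rewrite !Cmod_mult, Cmod_R.
  rewrite Rabs_pos_eq by apply sqrt_pos.
  apply Rmult_le_compat; try apply HM; try apply Cmod_ge_0; try exact Hz.
  - apply Rmult_le_pos; [apply sqrt_pos | apply Cmod_ge_0].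
  - apply Rmult_le_compat_l; [apply sqrt_pos |].
    apply qprod_le1; [| exact Hn].
    intros m Hm. apply Cmod_gt1_not_cut. assert (H := Hg m z Hm Hz). lra. }
destruct (Hbd N) as [M0 HM0]; [unfold N; lia |].
destruct (Hbd (S N)) as [M1 HM1]; [unfold N; lia |].
apply (unif_Cauchy_on_shift _ x N).
(* [K] is the Lipschitz constant of [zeta], applied to the increment of [alpha_n z + beta_n]. The
   leading 2 bounds [1 / k_{n+1} <= 2 / (1 + r)]. *)
set (e := fun n : nat => 2 * (Rabs (kratio a (S n) - 1)
   + K * (rho * Rabs (diff (alpha a) n) + Rabs (diff (beta a b) n)))).
apply (perturbed_contraction_Cauchy _ _ (r / ((1 + r) / 2)) (Rmax M0 M1) (fun n => e (N + n)%nat)).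
- split.
  + apply Rmult_le_pos; [lra | left; apply Rinv_0_lt_compat; lra].
  + apply Rmult_lt_reg_r with ((1 + r) / 2); [lra |].
    replace (r / ((1 + r) / 2) * ((1 + r) / 2)) with r by (field; lra). lra.
- intros n. unfold e.
  assert (Q1 := Rabs_pos (kratio a (S (N + n)) - 1)).
  assert (Q2 := Rabs_pos (diff (alpha a) (N + n)%nat)).
  assert (Q3 := Rabs_pos (diff (beta a b) (N + n)%nat)).
  assert (0 <= K * (rho * Rabs (diff (alpha a) (N + n)%nat) + Rabs (diff (beta a b) (N + n)%nat))).
  { apply Rmult_le_pos; [lra |]. apply Rplus_le_le_0_compat; [apply Rmult_le_pos; lra | lra]. }
  lra.
- apply (ex_series_incr_n e N). unfold e.
  apply (ex_series_scal (V := R_NormedModule) 2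
    (fun n : nat => Rabs (kratio a (S n) - 1)
      + K * (rho * Rabs (diff (alpha a) n) + Rabs (diff (beta a b) n)))).
  apply (ex_series_plus (V := R_NormedModule) (fun n : nat => Rabs (kratio a (S n) - 1))
     (fun n : nat => K * (rho * Rabs (diff (alpha a) n) + Rabs (diff (beta a b) n)))).
  + apply (ex_series_incr_1 (fun n : nat => Rabs (kratio a n - 1))), Hk.
  + apply (ex_series_scal (V := R_NormedModule) K
      (fun n : nat => rho * Rabs (diff (alpha a) n) + Rabs (diff (beta a b) n))).
    apply (ex_series_plus (V := R_NormedModule) (fun n : nat => rho * Rabs (diff (alpha a) n))
      (fun n : nat => Rabs (diff (beta a b) n))); [| exact Hbe].
    apply (ex_series_scal (V := R_NormedModule) rho
      (fun n : nat => Rabs (diff (alpha a) n))), Hal.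
- intros z Hz. rewrite Nat.add_0_r.
  eapply Rle_trans; [apply HM0, Hz | apply Rmax_l].
- intros z Hz. rewrite Nat.add_1_r.
  eapply Rle_trans; [apply HM1, Hz | apply Rmax_r].
- intros n z Hz. rewrite !Nat.add_succ_r. set (m := (N + n)%nat).
  assert (G0 := Hg m z ltac:(unfold m, N; lia) Hz).
  assert (G1 := Hg (S m) z ltac:(unfold m, N; lia) Hz).
  assert (Hcut : ~ in_cut (alpha a (S m) * z + beta a b (S m))%C)
    by (apply Cmod_gt1_not_cut; lra).
  assert (E := scaled_product_recurrence a b N0 m z (P z) Ha (proj1 (HP z))
    ltac:(unfold m, N; lia) Hcut).
  assert (Hkm := Hk2 (S m) ltac:(unfold m, N; lia)).
  assert (Z1 := Cmod_zeta_le_inv _ c Hc G1).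
  assert (L := zeta_Lipschitz _ _ c Hc G1 G0). fold K in L.
  assert (D : Cmod (alpha a (S m) * z + beta a b (S m) - (alpha a m * z + beta a b m))
     <= rho * Rabs (diff (alpha a) m) + Rabs (diff (beta a b) m)).
  { unfold diff. replace (Z.of_nat m + 1)%Z with (Z.of_nat (S m)) by lia.
    replace (alpha a (S m) * z + beta a b (S m) - (alpha a m * z + beta a b m))%C
      with (z * RtoC (alpha a (S m) - alpha a m) + RtoC (beta a b (S m) - beta a b m))%C
      by (rewrite !RtoC_minus; ring).
    eapply Rle_trans; [apply Cmod_triangle |]. rewrite Cmod_mult, !Cmod_R.
    apply Rplus_le_compat_r, Rmult_le_compat_r; [apply Rabs_pos | lra]. }
  set (z1 := zeta (alpha a (S m) * z + beta a b (S m))) in *.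
  set (z0 := zeta (alpha a m * z + beta a b m)) in *.
  set (k := kratio a (S m)) in *.
  change (k * (x (S (S m)) z - x (S m) z) = z1 * z1 * (x (S m) z - x m z)
    + (1 - k) * x (S m) z + z1 * (z1 - z0) * x m z)%C in E.
  unfold e. fold k.
  set (D0 := rho * Rabs (diff (alpha a) m) + Rabs (diff (beta a b) m)) in *.
  assert (L2 : Cmod (z1 - z0) <= K * D0).
  { eapply Rle_trans; [exact L |]. apply Rmult_le_compat_l; lra. }
  apply (f_equal Cmod) in E. rewrite Cmod_mult, Cmod_R, (Rabs_pos_eq k) in E by lra.
  assert (T1 := Cmod_triangle (z1 * z1 * (x (S m) z - x m z) + (1 - k) * x (S m) z)
    (z1 * (z1 - z0) * x m z)).
  assert (T2 := Cmod_triangle (z1 * z1 * (x (S m) z - x m z)) ((1 - k) * x (S m) z)).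
  rewrite (Cmod_mult (z1 * (z1 - z0))), (Cmod_mult z1 (z1 - z0)) in T1.
  rewrite (Cmod_mult (z1 * z1)), (Cmod_mult z1 z1), (Cmod_mult (1 - k)) in T2.
  assert (Ek : Cmod (1 - k) = Rabs (k - 1))
    by (rewrite <- RtoC_minus, Cmod_R; apply Rabs_minus_sym).
  rewrite Ek in T2.
  set (d2 := Cmod (x (S (S m)) z - x (S m) z)) in *.
  set (d1 := Cmod (x (S m) z - x m z)) in *.
  assert (P1 : 0 <= d1) by apply Cmod_ge_0.
  assert (P2 : 0 <= d2) by apply Cmod_ge_0.
  assert (X0 := Cmod_ge_0 (x m z)). assert (X1 := Cmod_ge_0 (x (S m) z)).
  set (x0 := Cmod (x m z)) in *. set (x1 := Cmod (x (S m) z)) in *.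
  assert (Y1 := Cmod_ge_0 z1). assert (Y2 := Cmod_ge_0 (z1 - z0)).
  assert (Q := Rabs_pos (k - 1)).
  set (y := Cmod z1) in *. set (dz := Cmod (z1 - z0)) in *. set (h := Rabs (k - 1)) in *.
  assert (B1 : y * y * d1 <= r * d1).
  { apply Rmult_le_compat_r; [exact P1 |]. unfold r. apply Rmult_le_compat; lra. }
  assert (B2 : y * dz * x0 <= K * D0 * x0).
  { apply Rmult_le_compat_r; [exact X0 |]. apply Rle_trans with (1 * dz); [| lra].
    apply Rmult_le_compat_r; lra. }
  assert (B3 : (1 + r) / 2 * d2 <= k * d2) by (apply Rmult_le_compat_r; lra).
  assert (B4 : (1 + r) / 2 * d2 <= r * d1 + (h + K * D0) * (x1 + x0)).
  { assert (0 <= h * x0) by (apply Rmult_le_pos; lra).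
    assert (0 <= K * D0 * x1) by (apply Rmult_le_pos; lra). lra. }
  apply Rmult_le_reg_l with ((1 + r) / 2); [lra |].
  eapply Rle_trans; [exact B4 |].
  replace ((1 + r) / 2 * (r / ((1 + r) / 2) * d1 + 2 * (h + K * D0) * (x1 + x0)))
    with (r * d1 + (1 + r) * ((h + K * D0) * (x1 + x0))) by (field; lra).
  assert (0 <= r * ((h + K * D0) * (x1 + x0))) by (repeat apply Rmult_le_pos; lra).
  lra.
Qed.

(** * Identification of the limit and the case of vanishing Wronskian *)

Lemma alpha_lim0 (a : Z -> R) :
  is_lim_seq (fun n : nat => a n) p_infty -> is_lim_seq (fun n : nat => alpha a n) 0.
Proof.
(* The shift avoids [alpha_0], which involves [a_{-1}], not a term of the sequence indexed by
   [nat]. *)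
intros H. apply is_lim_seq_incr_1.
assert (H1 : is_lim_seq (fun n : nat => a n * a (S n)) p_infty).
{ apply (is_lim_seq_mult _ _ p_infty p_infty); [exact H | | reflexivity].
  apply (is_lim_seq_incr_1 (fun n : nat => a n)), H. }
assert (H2 : is_lim_seq (fun n : nat => sqrt (a n * a (S n))) p_infty).
{ eapply filterlim_comp; [exact H1 | apply filterlim_sqrt_p]. }
assert (H3 := is_lim_seq_inv _ _ H2 ltac:(discriminate)).
apply (is_lim_seq_scal_l _ (/ 2)) in H3.
replace (Rbar_mult (/ 2) (Rbar_inv p_infty)) with (Finite 0) in H3
  by (simpl; rewrite Rmult_0_r; reflexivity).
eapply is_lim_seq_ext; [| exact H3].
intros n. unfold alpha. replace (Z.of_nat (S n) - 1)%Z with (Z.of_nat n) by lia.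
unfold Rdiv. rewrite Rinv_mult. ring.
Qed.

Theorem theorem6p6
  (a b : Z -> R) (beta_inf : R)
  (a_pos : forall n : Z, (-1 <= n)%Z -> 0 < a n)
  (a_lim : is_lim_seq (fun n : nat => a n) p_infty)
  (beta_lim : is_lim_seq (fun n : nat => beta a b n) beta_inf)
  (beta_inf_gt1 : 1 < Rabs beta_inf)
  (alpha_ell1 : ell1 (diff (alpha a)))
  (beta_ell1 : ell1 (diff (beta a b)))
  (k_ell1 : ell1 (fun n : Z => kratio a n - 1))
  (rho0 eps0 : R) (N0 : nat)
  (rho0_pos : 0 < rho0)
  (eps0_range : 0 < eps0 < Rabs beta_inf - 1)
  (N0_ge1 : (1 <= N0)%nat)
  (N0_close : forall (n : nat) (z : C), (N0 <= n)%nat -> Cmod z < rho0 ->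
     Cmod (alpha a n * z + beta a b n - beta_inf)%C < eps0)
  (P f g : C -> Z -> C)
  (P_def : forall z : C, is_orthogonal_polynomials a b z (P z))
  (f_def : forall z : C, Cmod z < rho0 -> is_Jost_solution a b N0 z (f z))
  (f_neq0 : forall (n : nat) (z : C), (N0 <= n)%nat -> Cmod z < rho0 ->
     f z n <> 0%C)
  (g_def : forall z : C, Cmod z < rho0 ->
     is_second_solution a b N0 z (f z) (g z)) :
  let Omega (z : C) : C := Wronskian a (P z) (f z) in
  let scaled_P (n : nat) (z : C) : C :=
    (sqrt (a n) * qprod a b N0 n z * P z n)%C in
  let limit (z : C) : C :=
    (- (varkappa_inf a * Omega z / (2 * Csqrt_sq1 beta_inf)))%C in
  (forall z : C, Cmod z < rho0 -> Clim (fun n => scaled_P n z) (limit z)) /\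
  (forall K : C -> Prop, compact_set K ->
     (forall z, K z -> Im z <> 0 /\ Cmod z < rho0) ->
     uniform_lim_on K scaled_P limit) /\
  (forall z : C, Cmod z < rho0 -> Omega z = 0%C ->
     Clim (fun n : nat => sqrt (a n) * / qprod a b N0 n z * P z n)%C
          (Wronskian a (P z) (g z)) /\
     Wronskian a (P z) (g z) <> 0%C).
Proof.
intros Omega scaled_P limit.
(* From [N0] on the arguments of [zeta] lie within [eps0] of [beta_inf], hence have modulus at least
   [c], and [c > 1] by the choice of [eps0]. *)
set (c := Rabs beta_inf - eps0).
assert (Hc : 1 < c) by (unfold c; lra).
assert (Hg : forall (n : nat) (z : C), (N0 <= n)%nat -> Cmod z < rho0 ->
  c <= Cmod (alpha a n * z + beta a b n)).
{ intros n z Hn Hz. assert (H := N0_close n z Hn Hz).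
  set (w := (alpha a n * z + beta a b n)%C) in *.
  assert (T := Cmod_triangle w (- (w - beta_inf))).
  replace (w + - (w - beta_inf))%C with (RtoC beta_inf) in T by ring.
  rewrite Cmod_opp, Cmod_R in T. unfold c. lra. }
assert (Hcut : forall z, Cmod z < rho0 -> forall n : nat, (N0 <= n)%nat ->
  ~ in_cut (alpha a n * z + beta a b n)%C).
{ intros z Hz n Hn. apply Cmod_gt1_not_cut. assert (H := Hg n z Hn Hz). lra. }
assert (HC : unif_Cauchy_on (fun z => Cmod z < rho0) scaled_P)
  by (apply (scaled_P_unif_Cauchy a b P rho0 c N0); assumption).
assert (Hbcut : ~ in_cut beta_inf) by (apply Cmod_gt1_not_cut; rewrite Cmod_R; lra).
assert (Hjost : forall z, Cmod z < rho0 -> exists eps : nat -> C, Clim eps 0 /\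
  eventually (fun n => sqrt (a n) * f z n = qprod a b N0 n z * (1 + eps n))%C).
{ intros z Hz. destruct (f_def z Hz) as [_ [eps [He [N HN]]]].
  exists eps; split; [exact He |]. exists N; intros n Hn. rewrite (HN n Hn).
  assert (S0 := sqrt_lt_R0 _ (a_pos n ltac:(lia))).
  assert (C0 : RtoC (sqrt (a n)) <> 0%C) by (intros F; injection F; lra).
  field. exact C0. }
assert (H1 : forall z : C, Cmod z < rho0 -> Clim (fun n => scaled_P n z) (limit z)).
{ intros z Hz.
  destruct (unif_Cauchy_on_Clim _ _ z HC Hz) as [l Hl].
  enough (E : l = limit z) by (rewrite <- E; exact Hl).
  destruct (Hjost z Hz) as [eps [He [N HN]]].
  set (ze := fun n : nat => zeta (alpha a n * z + beta a b n)).
  set (zi := zeta beta_inf).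
  assert (Hze : Clim ze zi).
  { apply Clim_Cmod. intros d Hd.
    assert (Hga : Clim (fun n => alpha a n * z + beta a b n)%C beta_inf).
    { apply (Clim_ext_loc (fun n => beta a b n - (0 - alpha a n * z))%C).
      - exists 0%nat; intros n _. ring.
      - replace (RtoC beta_inf) with (beta_inf - (0 - 0 * z))%C by ring.
        apply Clim_minus; [apply Clim_RtoC, beta_lim |].
        apply Clim_minus; [apply Clim_const |].
        apply Clim_mult; [apply Clim_RtoC, alpha_lim0, a_lim | apply Clim_const]. }
    set (L := 2 / (c * c - 1)).
    assert (HL : 0 < L) by (apply Rdiv_lt_0_compat; nra).
    destruct (proj1 (Clim_Cmod _ _) Hga (d / L)) as [N1 HN1];
      [apply Rdiv_lt_0_compat; assumption |].
    exists (N0 + N1)%nat; intros n Hn.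
    eapply Rle_lt_trans; [apply (zeta_Lipschitz _ _ c Hc) |]; fold L.
    - apply Hg; [lia | exact Hz].
    - rewrite Cmod_R. unfold c. lra.
    - replace d with (L * (d / L)) by (field; lra).
      apply Rmult_lt_compat_l; [exact HL |]. apply HN1. lia. }
  (* Multiplying the rescaled Wronskian identity by [ze n] supplies the missing factor, since
     [q_{n+1} = q_n ze_n]: the Jost asymptotics put [q_{n+1}] next to [P_n] and [q_n] next to
     [P_{n+1}]. *)
  assert (Hrec : eventually (fun n => ze n * (varkappa a n * Omega z)
     = scaled_P n z * (ze n * ze n) * (1 + eps (S n)) - scaled_P (S n) z * (1 + eps n))%C).
  { exists (N0 + N)%nat; intros n Hn.
    assert (W := scaled_Wronskian a (P z) (f z) n (a_pos n ltac:(lia)) (a_pos (n + 1)%Z ltac:(lia))).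
    rewrite (Wronskian_indep a b z (P z) (f z) (proj1 (P_def z)) (proj1 (f_def z Hz))) in W by lia.
    fold (Omega z) in W. rewrite W.
    replace (Z.of_nat n + 1)%Z with (Z.of_nat (S n)) by lia.
    rewrite (HN n), (HN (S n)) by lia.
    unfold scaled_P, qprod. rewrite Cprod_range_Sr by lia. fold (ze n). ring. }
  assert (Hp1 := Clim_1_plus _ He).
  assert (HA := Clim_mult _ _ _ _ Hze (Clim_mult _ _ _ _
    (Clim_RtoC _ _ (varkappa_is_lim a a_pos k_ell1)) (Clim_const (Omega z)))).
  assert (HB := Clim_minus _ _ _ _
    (Clim_mult _ _ _ _ (Clim_mult _ _ _ _ Hl (Clim_mult _ _ _ _ Hze Hze)) (proj1 (Clim_incr_1 _ _) Hp1))
    (Clim_mult _ _ _ _ (proj1 (Clim_incr_1 _ _) Hl) Hp1)).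
  cbv beta in HB.
  assert (E := Clim_unique _ _ _ (Clim_ext_loc _ _ _ Hrec HA) HB).
  assert (Hq := Csqrt_sq1_zeta _ Hbcut). fold zi in Hq.
  assert (Hz0 := zeta_neq0 _ Hbcut). fold zi in Hz0.
  (* A zero here would force [zi^2 = 1], against [|zi| <= 1 / |beta_inf| < 1]. *)
  assert (Hs0 : (2 * Csqrt_sq1 beta_inf <> 0)%C).
  { intros F. rewrite F, Cmult_0_r in Hq.
    assert (F2 : (zi * zi = 1)%C) by (transitivity (1 - (1 - zi * zi))%C; [ring | rewrite Hq; ring]).
    apply (f_equal Cmod) in F2. rewrite Cmod_mult, Cmod_1 in F2.
    assert (B := Cmod_zeta_le_inv beta_inf (Rabs beta_inf) beta_inf_gt1
      ltac:(rewrite Cmod_R; apply Rle_refl)).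
    fold zi in B.
    assert (/ Rabs beta_inf < 1) by (rewrite <- Rinv_1; apply Rinv_lt_contravar; lra).
    assert (B0 := Cmod_ge_0 zi). nra. }
  set (s := (2 * Csqrt_sq1 beta_inf)%C) in *.
  (* Both [scaled_P n z] and [scaled_P (S n) z] tend to [l], so the right side of [E] is
     [l zi^2 - l]; its sign is the minus sign of the limit. *)
  assert (E2 : (zi * (varkappa_inf a * Omega z) = - (zi * (l * s)))%C).
  { rewrite E. transitivity (- (l * (1 - zi * zi)))%C; [ring |]. rewrite Hq. ring. }
  assert (E3 : (varkappa_inf a * Omega z = - (l * s))%C).
  { transitivity (/ zi * (zi * (varkappa_inf a * Omega z)))%C; [field; exact Hz0 |].
    rewrite E2. field. exact Hz0. }
  unfold limit. fold s. rewrite E3. field. exact Hs0. }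
split; [exact H1 |]. split.
{ intros K _ HK. intros eps Heps.
  destruct (unif_Cauchy_on_uniform_lim _ _ _ HC H1 eps Heps) as [N HN].
  exists N; intros n Hn z Hz. apply HN; [exact Hn | apply HK, Hz]. }
intros z Hz HO.
destruct (P_def z) as [JP [Pm1 P0]]. assert (Jf := proj1 (f_def z Hz)).
destruct (g_def z Hz) as [Jg Hgn].
assert (Wfg : forall n : Z, (-1 <= n)%Z -> Wronskian_at a (f z) (g z) n = 1%C).
{ enough (W0 : Wronskian_at a (f z) (g z) (N0 + 1)%nat = 1%C).
  { intros n Hn. rewrite <- W0, !(Wronskian_indep a b z (f z) (g z) Jf Jg) by lia. reflexivity. }
  unfold Wronskian_at.
  replace (Z.of_nat (N0 + 1) + 1)%Z with (Z.of_nat (S (N0 + 1))) by lia.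
  rewrite (Hgn (N0 + 1)%nat), (Hgn (S (N0 + 1))) by lia.
  rewrite sum_n_Sm by lia.
  set (m := (N0 + 1)%nat).
  replace (Z.of_nat (S m) - 1)%Z with (Z.of_nat m) by lia.
  assert (F0 := f_neq0 m z ltac:(unfold m; lia) Hz).
  assert (F1 := f_neq0 (S m) z ltac:(unfold m; lia) Hz).
  assert (A0 := a_pos m ltac:(lia)).
  assert (C0 : RtoC (a m) <> 0%C) by (intros F; injection F; lra).
  set (T := sum_n_m _ m m).
  change (a m * (f z m * (f z (S m) * (T + / (a m * f z m * f z (S m))))
    - f z (S m) * (f z m * T)) = 1)%C.
  field. tauto. }
set (c0 := Wronskian a (P z) (g z)).
assert (HP : forall n : Z, (-1 <= n)%Z -> P z n = (c0 * f z n)%C).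
{ intros n Hn.
  assert (Wg := Wronskian_indep a b z (P z) (g z) JP Jg n Hn). fold c0 in Wg.
  assert (Wf := Wronskian_indep a b z (P z) (f z) JP Jf n Hn).
  change (Wronskian_at a (P z) (f z) n = Omega z) in Wf. rewrite HO in Wf.
  (* Pluecker relation between the three solutions. *)
  transitivity (Wronskian_at a (P z) (g z) n * f z n - Wronskian_at a (P z) (f z) n * g z n
    - P z n * (Wronskian_at a (f z) (g z) n - 1))%C.
  - unfold Wronskian_at. ring.
  - rewrite Wg, Wf, (Wfg n Hn). ring. }
split.
- destruct (Hjost z Hz) as [eps [He [N HN]]].
  (* Since [P = c0 f], division by [q_n] cancels the factor [q_n] in the Jost asymptotics. *)
  apply (Clim_ext_loc (fun n => c0 * (1 + eps n))%C).
  + exists (N0 + N)%nat; intros n Hn. rewrite (HP n) by lia.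
    assert (Q := qprod_neq0 a b N0 z (Hcut z Hz) n ltac:(lia)).
    transitivity (/ qprod a b N0 n z * c0 * (sqrt (a n) * f z n))%C; [| ring].
    rewrite HN by lia. field. exact Q.
  + assert (Q := Clim_mult _ _ _ _ (Clim_const c0) (Clim_1_plus _ He)).
    rewrite Cmult_1_r in Q. exact Q.
- intros E. assert (H := HP 0%Z ltac:(lia)). rewrite P0, E, Cmult_0_l in H.
  injection H; lra.
Qed.
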